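(* Let $k\ge 2$, let $c_1,\dots,c_k$ be positive integers, and let $(f[n])_{n\ge 1}$ be a sequence with positive integer initial values $f[1],\dots,f[k]$ satisfying $f[n]=c_1f[n-1]+c_2f[n-2]+\cdots+c_kf[n-k]$ for all $n>k$. Let $\alpha$ be the largest positive real root of $x^k-c_1x^{k-1}-\cdots-c_k=0$. For each positive integer $N$ let $\underline{X}_N$ be a random variable with values in $\{1,\dots,N\}$ and $P(\underline{X}_N=n)=\dfrac{f[N+1-n]}{\sum_{j=1}^{N}f[j]}$ for $1\le n\le N$. Then $$\lim_{N\to\infty}E(\underline{X}_N)=\frac{\alpha}{\alpha-1},\qquad \lim_{N\to\infty}\mathrm{Var}(\underline{X}_N)=\frac{\alpha}{(\alpha-1)^2}.$$
   Context: $E$ and $\mathrm{Var}$ denote expectation and variance. *)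

(* Defs.v *)
From mathcomp Require Import all_boot all_order all_algebra.
From mathcomp Require Import all_classical all_reals all_analysis.
Import GRing.Theory Num.Theory.

Set Implicit Arguments.
Unset Strict Implicit.
Unset Printing Implicit Defensive.

Local Open Scope ring_scope.

(* Both c and f are indexed from 1; the values c 0 and f 0 are never used. *)
Definition linear_recurrence (k : nat) (c f : nat -> nat) : Prop :=
  forall n : nat, (k < n)%N ->
    f n = (\sum_(1 <= i < k.+1) c i * f (n - i))%N.

Definition char_poly_rec (R : nzRingType) (k : nat) (c : nat -> nat) : {poly R} :=
  'X^k - \sum_(1 <= i < k.+1) (c i)%:R *: 'X^(k - i).

Definition largest_positive_root (R : realType) (p : {poly R}) (a : R) : Prop :=
  [/\ 0 < a, root p a & forall b : R, 0 < b -> root p b -> b <= a].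

(* Main.v *)
(** With [b = 1/alpha], the sequence [g n = b^n f n] is a moving average with
    weights [c_i b^i], which sum to 1 because [alpha] is a root. Windows of [k]
    consecutive values have geometrically shrinking oscillation, so [g] tends
    to some [L > 0]. The sums of [f (N+1-n)], [n f (N+1-n)] and [n^2 f (N+1-n)]
    satisfy [D (N+1) = D N + v (N+1)], where [v] is [f] or a combination of the
    previous sums; scaled by [b^N] this is [u (N+1) = b u N + v' (N+1)], whose
    limit is [lim v' / (1 - b)]. The limit [L] cancels in the moments. *)
Require Import Defs.
From mathcomp Require Import all_boot all_order all_algebra.
From mathcomp Require Import all_classical all_reals all_analysis.
From mathcomp Require Import ring lra zify.
Import Order.TTheory GRing.Theory Num.Theory numFieldNormedType.Exports.

Set Implicit Arguments.
Unset Strict Implicit.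
Unset Printing Implicit Defensive.

Local Open Scope classical_set_scope.
Local Open Scope ring_scope.

(** * Convergence of positive moving averages *)

Definition moving_average (R : nzRingType) (k : nat) (w g : nat -> R) : Prop :=
  forall n : nat, (k <= n)%N -> g n = \sum_(1 <= i < k.+1) w i * g (n - i)%N.

Section MovingAverage.
Variables (R : realType) (k : nat) (w : nat -> R).
Hypotheses (hk : (0 < k)%N) (w1_gt0 : 0 < w 1%N).
Hypothesis w_ge0 : forall i, (1 <= i <= k)%N -> 0 <= w i.
Hypothesis w_sum : \sum_(1 <= i < k.+1) w i = 1.

(** The weights sum to 1, so constants are solutions. This reduces two-sided bounds on [g] to
    nonnegativity of [g n - m] and [M - g n]. *)
Lemma moving_average_subl (g : nat -> R) (a : R) :
  moving_average k w g -> moving_average k w (fun n => a - g n).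
Proof.
move=> hg n kn; rewrite hg // -[X in X - _]mulr1 -w_sum mulr_sumr -sumrB.
by apply: eq_bigr => i _; ring.
Qed.

Lemma moving_average_subr (g : nat -> R) (a : R) :
  moving_average k w g -> moving_average k w (fun n => g n - a).
Proof.
move=> hg n kn; rewrite hg // -[X in _ - X]mulr1 -w_sum mulr_sumr -sumrB.
by apply: eq_bigr => i _; ring.
Qed.

Lemma moving_average_ge0 (h : nat -> R) (n : nat) :
  moving_average k w h -> (forall i, (i < k)%N -> 0 <= h (n + i)%N) ->
  forall j, (n <= j)%N -> 0 <= h j.
Proof.
move=> hh h0; elim/ltn_ind => j IH nj.
have [jk|kj] := ltnP j (n + k).
  by rewrite -(subnKC nj); apply: h0; lia.
rewrite hh ?(leq_trans _ kj) ?leq_addl // big_nat; apply: sumr_ge0 => i hi.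
by apply: mulr_ge0; [exact: w_ge0 | apply: IH; lia].
Qed.

(** All terms of the average are nonnegative, so each step keeps at least the share [w 1] of the
    preceding value. *)
Lemma moving_average_ge_geometric (h : nat -> R) (n i : nat) :
  moving_average k w h -> (forall j, (n <= j)%N -> 0 <= h j) ->
  w 1%N ^+ i * h (n + k.-1)%N <= h (n + k.-1 + i)%N.
Proof.
move=> hh h0; elim: i => [|i IH]; first by rewrite expr0 mul1r addn0.
rewrite [leRHS]hh; last lia.
rewrite big_nat_recl //= exprS -mulrA.
have -> : (n + k.-1 + i.+1 - 1 = n + k.-1 + i)%N by lia.
apply: le_trans (ler_wpM2l (ltW w1_gt0) IH) _.
rewrite lerDl big_nat; apply: sumr_ge0 => j hj.
by apply: mulr_ge0; [apply: w_ge0; lia | apply: h0; lia].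
Qed.

Lemma weight1_le1 : w 1%N <= 1.
Proof.
rewrite -w_sum big_nat_recl // lerDl big_nat; apply: sumr_ge0 => j hj.
by apply: w_ge0; lia.
Qed.

(* The last value of a window enters each of the next [k] averages with total
   weight at least [w 1 ^+ k], which pulls both bounds towards it. *)
Lemma moving_average_contract (g : nat -> R) (n : nat) (m M : R) :
  moving_average k w g ->
  (forall i, (i < k)%N -> m <= g (n + i)%N <= M) ->
  exists m' M', [/\ m <= m', M' - m' = (1 - w 1%N ^+ k) * (M - m) &
    forall i, (i < k)%N -> m' <= g (n + k + i)%N <= M'].
Proof.
move=> hg hW.
set y := g (n + k.-1)%N; set e := w 1%N ^+ k.
have e0 : 0 <= e by apply: exprn_ge0; exact: ltW.
have /andP[my yM] : m <= y <= M by apply: hW; lia.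
(* Each bound moves towards [y] by the fraction [e] of its distance; the two moves add up to
   [e * (M - m)] wherever [y] lies. *)
exists (m + e * (y - m)), (M - e * (M - y)); split.
- by rewrite lerDl mulr_ge0 // subr_ge0.
- by ring.
move=> i ik.
(* The next window lies 1 to [k] steps after [y], and [w 1 <= 1], so the single constant [e] serves
   all of it. *)
have le_e : e <= w 1%N ^+ i.+1.
  by apply: ler_wiXn2l ik; [exact: ltW | exact: weight1_le1].
have e_idx : (n + k.-1 + i.+1 = n + k + i)%N by lia.
have hl := moving_average_subr m hg; have hr := moving_average_subl M hg.
have hl0 : forall j, (n <= j)%N -> 0 <= g j - m.
  apply: moving_average_ge0 hl _ => j jk.
  by rewrite subr_ge0; case/andP: (hW j jk).
have hr0 : forall j, (n <= j)%N -> 0 <= M - g j.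
  apply: moving_average_ge0 hr _ => j jk.
  by rewrite subr_ge0; case/andP: (hW j jk).
have := moving_average_ge_geometric i.+1 hl hl0.
have := moving_average_ge_geometric i.+1 hr hr0.
rewrite /= e_idx -/y => h1 h2.
have h3 : e * (M - y) <= w 1%N ^+ i.+1 * (M - y).
  by rewrite ler_wpM2r // subr_ge0.
have h4 : e * (y - m) <= w 1%N ^+ i.+1 * (y - m).
  by rewrite ler_wpM2r // subr_ge0.
apply/andP; split; lra.
Qed.

(** The positive lower bound is what later keeps the limit away from 0. *)
Lemma positive_window_bounds (g : nat -> R) :
  (forall i, (i < k)%N -> 0 < g i) ->
  exists m M, 0 < m /\ forall i, (i < k)%N -> m <= g i <= M.
Proof.
elim: k => [|l IH] g0; first by exists 1, 1; split=> //; rewrite ltr01.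
have [i il|m [M [m0 hb]]] := IH; first by apply: g0; lia.
exists (Num.min m (g l)), (Num.max M (g l)); split.
  by rewrite lt_min m0 g0.
move=> i; rewrite ltnS leq_eqVlt => /orP[/eqP->|/hb/andP[h1 h2]].
  by rewrite ge_min le_max lexx !orbT.
by rewrite ge_min le_max h1 h2.
Qed.

Lemma moving_average_cvg (g : nat -> R) :
  moving_average k w g -> (forall i, (i < k)%N -> 0 < g i) ->
  exists2 L : R, 0 < L & g n @[n --> \oo] --> L.
Proof.
move=> hg g0; have [m0 [M0 [m0_gt0 hW0]]] := positive_window_bounds g0.
set q := 1 - w 1%N ^+ k.
have hW t : exists m M, [/\ m0 <= m, M - m = q ^+ t * (M0 - m0) &
    forall i, (i < k)%N -> m <= g (t * k + i)%N <= M].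
  elim: t => [|t [m [M [h1 h2 h3]]]].
    by exists m0, M0; split=> //; rewrite expr0 mul1r.
  have [m' [M' [h4 h5 h6]]] := moving_average_contract hg h3.
  exists m', M'; split; first exact: le_trans h4.
    by rewrite h5 h2 exprS mulrA.
  by move=> i ik; rewrite mulSn (addnC k); exact: h6.
(* Bounds on one window persist at all later indices, since averaging preserves nonnegativity. *)
have hB t : exists m M, [/\ m0 <= m, M - m = q ^+ t * (M0 - m0) &
    forall j, (t * k <= j)%N -> m <= g j <= M].
  have [m [M [h1 h2 h3]]] := hW t; exists m, M; split=> // j tj.
  apply/andP; split; rewrite -subr_ge0.
    apply: (moving_average_ge0 (moving_average_subr m hg)) tj => i ik /=.
    by rewrite subr_ge0; case/andP: (h3 i ik).
  apply: (moving_average_ge0 (moving_average_subl M hg)) tj => i ik /=.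
  by rewrite subr_ge0; case/andP: (h3 i ik).
have q_lt1 : `|q| < 1.
  have : 0 < w 1%N ^+ k by exact: exprn_gt0.
  have : w 1%N ^+ k <= 1 by apply: exprn_ile1; [exact: ltW|exact: weight1_le1].
  by rewrite /q => ? ?; rewrite ger0_norm; lra.
(* Once [q ^+ t * (M0 - m0) < e], all values from index [t * k] on lie in the ball of radius [e]
   around the lower bound [m]. *)
have gcvg : cvg (g n @[n --> \oo]).
  apply/cauchy_cvgP/cauchy_exP => e e0.
  have : q ^+ t * (M0 - m0) @[t --> \oo] --> 0 * (M0 - m0).
    by apply: cvgMl; exact: cvg_expr.
  rewrite mul0r => /cvgrPdist_lt /(_ e e0) [t _ /(_ t (leqnn t))] /=.
  rewrite sub0r normrN => ht; have [m [M [h1 h2 h3]]] := hB t.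
  exists m, (t * k)%N => // j /= tj; have /andP[h4 h5] := h3 j tj.
  rewrite /ball /= distrC ger0_norm ?subr_ge0 //.
  apply: le_lt_trans ht; rewrite -h2; apply: le_trans (ler_norm _).
  by rewrite lerD2r.
exists (lim (g n @[n --> \oo])) => //.
apply: lt_le_trans m0_gt0 _; apply: limr_ge => //.
have [m [M [h1 _ h3]]] := hB 0%N; exists 0%N => // j _ /=.
by apply: le_trans h1 _; case/andP: (h3 j (leq0n j)).
Qed.

End MovingAverage.

(** * Affine recurrences with a convergent source term *)

Lemma cvg_affine_recurrence (R : realType) (b l : R) (u v : nat -> R) :
  0 <= b < 1 -> (forall n, u n.+1 = b * u n + v n.+1) ->
  v n @[n --> \oo] --> l -> u n @[n --> \oo] --> l / (1 - b).
Proof.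
move=> /andP[b0 b1] hu hv; set a := l / (1 - b).
have c0 : 0 < 1 - b by rewrite subr_gt0.
have ha : a * (1 - b) = l by rewrite /a divfK // gt_eqF.
apply/cvgrPdist_le => e e0.
(* With this tolerance on [v], the value [e / 2] is the fixed point of the error recursion, so the
   accumulated error never exceeds [e / 2]; the initial error decays like [b ^+ j]. *)
have e2 : 0 < e / 2 * (1 - b) by rewrite mulr_gt0 // divr_gt0.
move/cvgrPdist_le: hv => /(_ _ e2) [N _ hN].
have hj j : `|a - u (N + j)%N| <= b ^+ j * `|a - u N| + e / 2.
  elim: j => [|j IH].
    by rewrite addn0 expr0 mul1r lerDl divr_ge0 // ltW.
  have := hN (N + j.+1)%N (leq_addr _ _); rewrite /= addnS => h1.
  have -> : a - u (N + j).+1 = b * (a - u (N + j)%N) + (l - v (N + j).+1).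
    by rewrite hu -ha; ring.
  apply: le_trans (ler_normD _ _) _; rewrite normrM (ger0_norm b0).
  have := ler_wpM2l b0 IH; rewrite exprS; lra.
have : b ^+ j * `|a - u N| @[j --> \oo] --> 0 * `|a - u N|.
  by apply: cvgMl; apply: cvg_expr; rewrite ger0_norm.
rewrite mul0r => /cvgrPdist_le /(_ (e / 2)) [|J _ hJ]; first by rewrite divr_gt0.
exists (N + J)%N => // n /= Jn.
have := hJ (n - N)%N; rewrite /= sub0r normrN => /(_ _).
have -> : (J <= n - N)%N by lia.
move=> /(_ isT) h; have := hj (n - N)%N; rewrite subnKC; last lia.
have := ler_norm (b ^+ (n - N) * `|a - u N|); lra.
Qed.

(** * Unnormalised moments and their limits *)

Definition convolution_sum (R : nzRingType) (F phi : nat -> R) (N : nat) : R :=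
  \sum_(1 <= n < N.+1) phi n * F (N + 1 - n)%N.

(** Peeling off [n = 1] shifts only the argument of [phi]; for polynomial [phi] the shift expands
    into lower moments. *)
Lemma convolution_sumS (R : nzRingType) (F phi : nat -> R) (N : nat) :
  convolution_sum F phi N.+1 =
  phi 1%N * F N.+1 + convolution_sum F (fun n => phi n.+1) N.
Proof.
rewrite /convolution_sum big_nat_recl // addn1 subn1; congr (_ + _).
by apply: eq_big_nat => i _; congr (_ * F _); lia.
Qed.

Section Moments.
Variables (R : realType) (F : nat -> R) (b L : R).
Hypothesis b01 : 0 <= b < 1.
Hypothesis FL : b ^+ n * F n @[n --> \oo] --> L.

Local Notation D := (convolution_sum F).

Lemma moment0_cvg :
  b ^+ N * D (fun=> 1) N @[N --> \oo] --> L / (1 - b).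
Proof.
apply: (cvg_affine_recurrence b01 _ FL) => n.
by rewrite convolution_sumS exprS; ring.
Qed.

Lemma convolution_sum_idS (N : nat) :
  D (fun n => n%:R) N.+1 = D (fun n => n%:R) N + D (fun=> 1) N.+1.
Proof.
rewrite !convolution_sumS addrCA; congr (_ + _).
rewrite -big_split /=; apply: eq_bigr => i _.
by rewrite -natr1; ring.
Qed.

Lemma moment1_cvg :
  b ^+ N * D (fun n => n%:R) N @[N --> \oo] --> L / (1 - b) / (1 - b).
Proof.
apply: (cvg_affine_recurrence b01 _ moment0_cvg) => n.
by rewrite convolution_sum_idS exprS; ring.
Qed.

(** Comes from [(n + 1)^2 = n^2 + 2n + 1]. The lower moments are taken at [N.+1] so that, scaled by
    [b ^+ N.+1], their limits are already known. *)
Lemma convolution_sum_sqrS (N : nat) :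
  D (fun n => n%:R ^+ 2) N.+1 =
  D (fun n => n%:R ^+ 2) N + (2 * D (fun n => n%:R) N.+1 - D (fun=> 1) N.+1).
Proof.
rewrite convolution_sum_idS.
have -> : D (fun n => n%:R ^+ 2) N.+1 = 1 * F N.+1 + (D (fun n => n%:R ^+ 2) N +
    (2 * D (fun n => n%:R) N + D (fun=> 1) N)).
  rewrite convolution_sumS expr1n; congr (_ + _).
  rewrite [2 * _]mulr_sumr -!big_split /=; apply: eq_bigr => i _.
  by rewrite -natr1; ring.
by rewrite convolution_sumS; ring.
Qed.

Lemma moment2_cvg :
  b ^+ N * D (fun n => n%:R ^+ 2) N @[N --> \oo] -->
  (2 * (L / (1 - b) / (1 - b)) - L / (1 - b)) / (1 - b).
Proof.
have h : 2 * (b ^+ N * D (fun n => n%:R) N) - b ^+ N * D (fun=> 1) N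
    @[N --> \oo] --> 2 * (L / (1 - b) / (1 - b)) - L / (1 - b).
  by apply: cvgB moment0_cvg; apply: cvgMr; exact: moment1_cvg.
apply: (cvg_affine_recurrence b01 _ h) => n.
by rewrite convolution_sum_sqrS exprS; ring.
Qed.

End Moments.

(** * Moments of a random variable with values in 1, ..., N *)

Lemma expectation_comp_natr (d : measure_display) (T : measurableType d)
    (R : realType) (P : probability T R) (X : {RV P >-> R}) (N : nat)
    (phi : R -> R) (p : nat -> R) :
  (forall t, exists2 n : nat, (1 <= n <= N)%N & X t = n%:R) ->
  (forall n, (1 <= n <= N)%N -> P [set t | X t = n%:R] = (p n)%:E) ->
  ('E_P[phi \o X])%E = (\sum_(1 <= n < N.+1) phi n%:R * p n)%:E.
Proof.
move=> hX hp; rewrite unlock.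
pose A (n : nat) := [set t | X t = n%:R].
have mA n : measurable (A n).
  have -> : A n = X @^-1` [set n%:R] by [].
  by rewrite -[X in measurable X]setTI; exact: measurable_funP.
have mI n : P.-integrable setT (fun t => (\1_(A n) t)%:E).
  exact: integrable_indic.
(* At each [t] exactly one level set [A n] contributes, so [phi \o X] is a finite combination of
   indicators. *)
transitivity (\int[P]_t (\sum_(1 <= n < N.+1)
    ((phi n%:R)%:E * (\1_(A n) t)%:E)))%E.
  apply: eq_integral => t _; have [n hn Xn] := hX t.
  have nN : n \in index_iota 1 N.+1 by rewrite mem_index_iota.
  rewrite (bigD1_seq n) ?iota_uniq //= big1_seq => [|i /andP[ni _]].
    by rewrite adde0 indicE mem_set // mule1 Xn.
  rewrite indicE memNset ?mule0 // /A /= Xn => /eqP.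
  by rewrite eqr_nat eq_sym (negbTE ni).
rewrite integral_sum //; last by move=> n; exact: integrableZl.
rewrite -sumEFin big_nat [RHS]big_nat; apply: eq_bigr => n hn.
by rewrite integralZl // integral_indic // setIT EFinM -hp.
Qed.

Lemma variance_comp_natr (d : measure_display) (T : measurableType d)
    (R : realType) (P : probability T R) (X : {RV P >-> R}) (N : nat)
    (p : nat -> R) :
  (forall t, exists2 n : nat, (1 <= n <= N)%N & X t = n%:R) ->
  (forall n, (1 <= n <= N)%N -> P [set t | X t = n%:R] = (p n)%:E) ->
  ('V_P[X])%E = (\sum_(1 <= n < N.+1) n%:R ^+ 2 * p n
                 - (\sum_(1 <= n < N.+1) n%:R * p n) ^+ 2)%:E.
Proof.
move=> hX hp; have hE phi := expectation_comp_natr phi hX hp.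
(* The total mass is the expectation of the constant 1. *)
have p_sum : \sum_(1 <= n < N.+1) p n = 1.
  apply: EFin_inj; rewrite -[RHS](expectation_cst P 1).
  transitivity ('E_P[cst 1%R \o X])%E => //.
  by rewrite hE; congr EFin; apply: eq_bigr => n _; rewrite mul1r.
rewrite /variance unlock; set m := fine _.
have mE : m = \sum_(1 <= n < N.+1) n%:R * p n by rewrite /m (hE id).
transitivity ('E_P[(fun x => (x - m) ^+ 2)%R \o X])%E => //.
rewrite hE -mE; congr EFin.
transitivity (\sum_(1 <= n < N.+1) (n%:R ^+ 2 * p n - 2 * m * (n%:R * p n)
    + m ^+ 2 * p n)); first by apply: eq_bigr => n _; ring.
by rewrite big_split sumrB /= -!mulr_sumr p_sum -mE; ring.
Qed.

(** * Growth of the linear recurrence *)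

Section Recurrence.
Variables (R : realType) (k : nat) (c f : nat -> nat) (alpha : R).
Hypothesis hk : (2 <= k)%N.
Hypothesis hc : forall i : nat, (1 <= i <= k)%N -> (0 < c i)%N.
Hypothesis alpha_gt0 : 0 < alpha.
Hypothesis alpha_root : root (char_poly_rec R k c) alpha.

(** The characteristic equation divided by [alpha ^+ k]. *)
Lemma char_weights_sum : \sum_(1 <= i < k.+1) (c i)%:R * alpha^-1 ^+ i = 1.
Proof.
move: alpha_root; rewrite rootE /char_poly_rec hornerD hornerN hornerXn.
rewrite horner_sum subr_eq0 => /eqP h.
have ak : alpha ^+ k != 0 by rewrite expf_neq0 // gt_eqF.
apply: (mulfI ak); rewrite mulr1 [RHS]h mulr_sumr big_nat [RHS]big_nat.
apply: eq_bigr => i /andP[i1 ik]; rewrite hornerZ hornerXn.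
rewrite -{1}(subnK (n := k) (m := i)) // exprD mulrCA -mulrA -exprMn.
by rewrite mulfV ?expr1n ?mulr1 // gt_eqF.
Qed.

(** If [alpha <= 1], the terms [i = 1] and [i = 2] of the weight sum are each at least 1, so the sum
    could not be 1. *)
Lemma char_root_gt1 : 1 < alpha.
Proof.
rewrite ltNge; apply/negP => a1.
have b1 i : 1 <= alpha^-1 ^+ i by rewrite exprn_ege1 // invf_ge1.
have t1 i : (1 <= i <= k)%N -> 1 <= (c i)%:R * alpha^-1 ^+ i.
  move=> hi; rewrite -[leLHS]mulr1; apply: ler_pM => //.
  by rewrite ler1n hc.
have h3 : 0 <= \sum_(3 <= i < k.+1) (c i)%:R * alpha^-1 ^+ i.
  apply: sumr_ge0 => i _; rewrite mulr_ge0 // exprn_ge0 // invr_ge0.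
  exact: ltW.
have h1 := t1 1%N (ltnW hk); have h2 := t1 2%N hk.
have := char_weights_sum.
rewrite big_ltn; last exact: ltnW hk.
rewrite big_ltn; last exact: hk.
by move=> h; lra.
Qed.

Lemma linear_recurrence_growth :
  (forall i : nat, (1 <= i <= k)%N -> (0 < f i)%N) ->
  linear_recurrence k c f ->
  exists2 L : R, 0 < L & alpha^-1 ^+ n * (f n)%:R @[n --> \oo] --> L.
Proof.
move=> hf hrec.
have b_gt0 : 0 < alpha^-1 by rewrite invr_gt0.
pose w i : R := (c i)%:R * alpha^-1 ^+ i.
(* The shift reconciles [f], indexed from 1, with windows that start at 0; it is undone in the limit
   at the end. *)
pose g n : R := alpha^-1 ^+ n.+1 * (f n.+1)%:R.
have k_gt0 : (0 < k)%N by lia.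
have w1_gt0 : 0 < w 1%N by rewrite mulr_gt0 ?exprn_gt0 // ltr0n hc //; lia.
have w_ge0 i : (1 <= i <= k)%N -> 0 <= w i.
  by move=> _; rewrite mulr_ge0 // exprn_ge0 // ltW.
have hg : moving_average k w g.
  move=> n kn; rewrite /g hrec // natr_sum mulr_sumr big_nat [RHS]big_nat.
  apply: eq_bigr => i /andP[i1 ik]; rewrite natrM.
  have -> : (n.+1 - i = (n - i).+1)%N by lia.
  have -> : n.+1 = (i + (n - i).+1)%N by lia.
  by rewrite exprD /w; ring.
have g0 i : (i < k)%N -> 0 < g i.
  by move=> ik; rewrite mulr_gt0 ?exprn_gt0 // ltr0n hf.
have [L L0 hL] :=
  moving_average_cvg k_gt0 w1_gt0 w_ge0 char_weights_sum hg g0.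
exists L => //.
by rewrite -(cvg_shiftS (fun n => alpha^-1 ^+ n * (f n)%:R)).
Qed.

End Recurrence.

(** * Limits of the expectation and the variance *)

Theorem mainTheorem7 (R : realType) (k : nat) (c f : nat -> nat) (alpha : R)
    (hk : (2 <= k)%N)
    (hc : forall i : nat, (1 <= i <= k)%N -> (0 < c i)%N)
    (hf : forall i : nat, (1 <= i <= k)%N -> (0 < f i)%N)
    (hrec : linear_recurrence k c f)
    (halpha : largest_positive_root (char_poly_rec R k c) alpha)
    (d : nat -> measure_display) (T : forall N : nat, measurableType (d N))
    (P : forall N : nat, probability (T N) R)
    (X : forall N : nat, {RV (P N) >-> R})
    (hXrange : forall N : nat, (1 <= N)%N -> forall t : T N,
       exists2 n : nat, (1 <= n <= N)%N & X N t = n%:R)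
    (hXlaw : forall N n : nat, (1 <= n <= N)%N ->
       P N [set t | X N t = n%:R] =
         ((f (N + 1 - n)%N)%:R / (\sum_(1 <= j < N.+1) f j)%N%:R)%:E) :
  ('E_(P N)[X N]%E @[N --> \oo] --> (alpha / (alpha - 1))%:E) /\
  ('V_(P N)[X N]%E @[N --> \oo] --> (alpha / (alpha - 1) ^+ 2)%:E).
Proof.
have [alpha_gt0 alpha_root _] := halpha.
have alpha_gt1 := char_root_gt1 hk hc alpha_gt0 alpha_root.
have [L L_gt0 hL] :=
  linear_recurrence_growth hk hc alpha_gt0 alpha_root hf hrec.
set b := alpha^-1 in hL.
have b_gt0 : 0 < b by rewrite invr_gt0.
have b01 : 0 <= b < 1 by rewrite ltW //= invf_lt1.
pose F n : R := (f n)%:R.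
pose D phi N := convolution_sum F phi N.
(* Reversing the summation turns the normalising constant into the zeroth moment. *)
have S_E N : (\sum_(1 <= j < N.+1) f j)%N%:R = D (fun=> 1) N.
  rewrite natr_sum /D /convolution_sum big_nat_rev /=.
  by apply: eq_big_nat => i _; rewrite mul1r /F; congr (f _)%:R; lia.
have pE N (phi : nat -> R) : \sum_(1 <= n < N.+1)
    phi n * (F (N + 1 - n)%N / D (fun=> 1) N) = D phi N / D (fun=> 1) N.
  by rewrite /D mulr_suml; apply: eq_bigr => n _; rewrite mulrA.
have hlaw N n : (1 <= n <= N)%N ->
    P N [set t | X N t = n%:R] = (F (N + 1 - n)%N / D (fun=> 1) N)%:E.
  by move=> hn; rewrite hXlaw // S_E.
pose s N := b ^+ N * D (fun=> 1) N.
have b_neq0 N : b ^+ N != 0 by rewrite expf_neq0 // gt_eqF.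
have ratioE phi N : D phi N / D (fun=> 1) N = b ^+ N * D phi N / s N.
  by rewrite /s -mulf_div divff // mul1r.
have c_neq0 : 1 - b != 0 by rewrite gt_eqF // subr_gt0; case/andP: b01.
have S_neq0 : L / (1 - b) != 0 by rewrite mulf_neq0 ?invr_neq0 // gt_eqF.
have cvg_ratio phi (l : R) : b ^+ N * D phi N @[N --> \oo] --> l ->
    D phi N / D (fun=> 1) N @[N --> \oo] --> l / (L / (1 - b)).
  move=> hl; under eq_fun do rewrite ratioE.
  by apply: cvgM hl _; apply: cvgV => //; exact: moment0_cvg.
have m1 := cvg_ratio _ _ (moment1_cvg b01 hL).
have m2 := cvg_ratio _ _ (moment2_cvg b01 hL).
have L_neq0 : L != 0 by rewrite gt_eqF.
have alpha_neq0 : alpha != 0 by rewrite gt_eqF.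
have alpha1_neq0 : alpha - 1 != 0 by rewrite gt_eqF // subr_gt0.
split.
  (* The right side is [1 / (1 - b)] with [b = 1 / alpha]. *)
  have -> : alpha / (alpha - 1) = L / (1 - b) / (1 - b) / (L / (1 - b)).
    rewrite /b; field.
    by rewrite alpha1_neq0 alpha_neq0.
  apply: (@cvg_trans _ ((D (fun n => n%:R) N / D (fun=> 1) N)%:E @[N --> \oo])).
    (* The range of [X N] is prescribed only for [N >= 1], so the moment formula is used
       eventually. *)
    apply: near_eq_cvg; near=> N.
    have N1 : (1 <= N)%N by near: N; exists 1%N.
    rewrite -pE; symmetry.
    exact: (expectation_comp_natr id (hXrange N N1) (hlaw N)).
  by apply: cvg_EFin => //; exact: nearW.
(* The right side is [(1 + b) / (1 - b)^2 - 1 / (1 - b)^2 = b / (1 - b)^2]. *)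
have -> : alpha / (alpha - 1) ^+ 2 =
    (2 * (L / (1 - b) / (1 - b)) - L / (1 - b)) / (1 - b) / (L / (1 - b))
    - (L / (1 - b) / (1 - b) / (L / (1 - b))) ^+ 2.
  rewrite /b; field.
  by rewrite alpha1_neq0 alpha_neq0.
apply: (@cvg_trans _ ((D (fun n => n%:R ^+ 2) N / D (fun=> 1) N
    - (D (fun n => n%:R) N / D (fun=> 1) N) ^+ 2)%:E @[N --> \oo])).
  apply: near_eq_cvg; near=> N.
  have N1 : (1 <= N)%N by near: N; exists 1%N.
  rewrite -!pE; symmetry.
  exact: (variance_comp_natr (hXrange N N1) (hlaw N)).
apply: cvg_EFin => //=; first exact: nearW.
exact: cvgB m2 (cvgM m1 m1).
Unshelve. all: by end_near.
Qed.
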